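(* For any integers $r,n$ with $2\le r\le n$ there exists a connected graph $G$ of order $n$ with $pd_s(G)=r$.
   Context: Graphs are finite, simple, connected; $d_G$ is shortest-path distance, $d_G(x,W)=\min\{d_G(x,w):w\in W\}$. A set $W$ of vertices strongly resolves two different vertices $x,y\notin W$ if $d_G(x,W)=d_G(x,y)+d_G(y,W)$ or $d_G(y,W)=d_G(y,x)+d_G(x,W)$. An ordered vertex partition $\Pi$ of $G$ is a strong resolving partition if every two different vertices in the same set of $\Pi$ are strongly resolved by some set of $\Pi$; the strong partition dimension $pd_s(G)$ is the minimum cardinality of a strong resolving partition. *)

(* Defs.v *)
From mathcomp Require Import all_boot.

Set Implicit Arguments.
Unset Strict Implicit.
Unset Printing Implicit Defensive.

(** Strong partition dimension of finite simple connected graphs. *)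

Record cgraph := CGraph {
  vertex :> finType;
  adj : rel vertex;
  adj_sym : symmetric adj;
  adj_irrefl : irreflexive adj;
  adj_connected : forall x y, connect adj x y }.

Definition walk_of_length (G : cgraph) (x y : G) (k : nat) : bool :=
  [exists p : k.-tuple G, path (@adj G) x p && (last x p == y)].

Lemma walk_exists (G : cgraph) (x y : G) : exists k, walk_of_length x y k.
Proof.
have /connectP[p xp ->] := adj_connected x y.
by exists (size p); apply/existsP; exists (in_tuple p); rewrite /= xp eqxx.
Qed.

Definition dist (G : cgraph) (x y : G) : nat := ex_minn (walk_exists x y).

(** Distances are smaller than [#|G|], so for nonempty [W] (in particular for
    every block of a partition) the default value of the iterated minimum plays
    no role. *)
Definition dist_set (G : cgraph) (x : G) (W : {set G}) : nat :=
  \big[minn/#|G|]_(w in W) dist x w.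

Definition strongly_resolves (G : cgraph) (W : {set G}) (x y : G) : bool :=
  [&& x != y, x \notin W, y \notin W &
      (dist_set x W == dist x y + dist_set y W)
      || (dist_set y W == dist y x + dist_set x W)].

(** Blocks are listed without repetition, so the cardinality of the partition
    is the length of the list. *)
Definition ordered_partition (G : cgraph) (Pi : seq {set G}) : bool :=
  uniq Pi && partition [set:: Pi] [set: G].

Definition strong_resolving_partition (G : cgraph) (Pi : seq {set G}) : bool :=
  ordered_partition Pi &&
  all (fun A : {set G} =>
         [forall x in A, forall y in A,
            (x != y) ==> has (fun W => strongly_resolves W x y) Pi]) Pi.

Definition has_strong_resolving_partition (G : cgraph) (k : nat) : bool :=
  [exists Pi : k.-tuple {set G}, strong_resolving_partition Pi].

Lemma strong_resolving_partition_exists (G : cgraph) :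
  exists k, has_strong_resolving_partition G k.
Proof.
pose s := [seq [set x] | x <- enum G].
have sP A : reflect (exists x, A = [set x]) (A \in s).
  apply: (iffP mapP) => [[x _ ->]|[x ->]]; exists x => //.
  by rewrite mem_enum.
exists (size s); apply/existsP; exists (in_tuple s).
apply/andP; split; last first.
  apply/allP => A /sP[x ->]; apply/forall_inP => y /set1P->.
  by apply/forall_inP => z /set1P->; rewrite eqxx.
apply/andP; split; first by rewrite map_inj_uniq ?enum_uniq //; exact: set1_inj.
apply/and3P; split.
- apply/eqP/setP => x; rewrite inE; apply/bigcupP; exists [set x]; last exact: set11.
  by rewrite inE; apply/sP; exists x.
- apply/trivIsetP => A B; rewrite !inE => /sP[x ->] /sP[y ->] neq.
  by rewrite disjoints1 inE; apply: contra neq => /eqP->.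
- by rewrite inE; apply/sP => -[x] /setP/(_ x); rewrite !inE eqxx.
Qed.

Definition pd_s (G : cgraph) : nat :=
  ex_minn (strong_resolving_partition_exists G).

(* Main.v *)
Require Import Defs.
From mathcomp Require Import all_boot.
From mathcomp Require Import zify.

(** For r = m + 2 take the lollipop graph on 0, ..., n - 1: the clique on
    0, ..., m + 1 with the path m + 1, ..., n - 1 attached. The blocks {0}, ...,
    {m}, {m + 1, ..., n - 1} form a strong resolving partition, the last block
    being resolved by {0}.

    Conversely, suppose that there are fewer than m + 2 blocks. Two of the twins
    0, ..., m are at the same distance from any block avoiding both, so the twins
    lie in distinct blocks and every block contains one of them. By pigeonhole
    two vertices of the clique share a block; any block avoiding both contains a
    twin, hence is at distance 1 from both and does not resolve them. *)

(** * Distances in an arbitrary graph *)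

(** The first two hypotheses make [d x y] a lower bound for the length of any walk; the third builds
    a walk of exactly that length. *)
Lemma dist_unique {G : cgraph} (d : G -> G -> nat) :
    (forall x, d x x = 0) ->
    (forall x y z, adj x z -> d x y <= (d z y).+1) ->
    (forall x y, x != y -> exists2 z, adj x z & d x y = (d z y).+1) ->
  forall x y, dist x y = d x y.
Proof.
move=> dxx d_adj d_step x y; rewrite /dist; case: ex_minnP => k.
case/existsP=> p /andP[xp /eqP yE] kmin; apply/eqP; rewrite eqn_leq.
apply/andP; split; last first.
  rewrite -(size_tuple p); case: p xp yE => p /= _.
  elim: p x {kmin} => [|z p IHp] x /=; first by move=> _ ->; rewrite dxx.
  by case/andP=> xz zp zy; apply: leq_trans (d_adj _ _ _ xz) _; rewrite ltnS IHp.
apply: kmin; move dxy: (d x y) => l.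
elim: l x dxy {k p xp yE} => [|k IHk] x dxy.
  have [->|/d_step[t _]] := eqVneq x y; last by rewrite dxy.
  by apply/existsP; exists [tuple]; rewrite /= eqxx.
have [xy|/d_step[t xt]] := eqVneq x y; first by rewrite xy dxx in dxy.
rewrite dxy => -[/esym /IHk /existsP[q /andP[tq qy]]].
by apply/existsP; exists [tuple of t :: q]; rewrite /= xt tq.
Qed.

Lemma dist_eq0 {G : cgraph} (x y : G) : (dist x y == 0) = (x == y).
Proof.
rewrite /dist; case: ex_minnP => k /existsP[p /andP[xp /eqP yE]] kmin.
apply/eqP/eqP => [k0|xy].
  by subst k; move: yE; rewrite (tuple0 p).
apply/eqP; rewrite -leqn0; apply: kmin.
by apply/existsP; exists [tuple]; rewrite /= xy eqxx.
Qed.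

Lemma dist_adj {G : cgraph} {x y : G} : adj x y -> dist x y <= 1.
Proof.
move=> xy; rewrite /dist; case: ex_minnP => k _; apply.
by apply/existsP; exists [tuple y]; rewrite /= xy eqxx.
Qed.

Lemma dist_set_le {G : cgraph} (x : G) {w : G} {W : {set G}} :
  w \in W -> dist_set x W <= dist x w.
Proof.
rewrite /dist_set => wW; have := mem_index_enum w.
elim: (index_enum G) => [|z s IHs] //; rewrite inE big_cons.
case/orP=> [/eqP <-|/IHs ws]; first by rewrite wW geq_minl.
by case: ifP => // _; apply: leq_trans ws; apply: geq_minr.
Qed.

(** The bound [k <= #|G|] handles the default value of the iterated minimum. *)
Lemma dist_set_ge {G : cgraph} {x : G} {W : {set G}} {k : nat} :
  k <= #|G| -> (forall w, w \in W -> k <= dist x w) -> k <= dist_set x W.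
Proof.
move=> kG kW; rewrite /dist_set; apply: (big_ind (leq k)) => // a b ka kb.
by rewrite leq_min ka.
Qed.

Lemma dist_set_adj {G : cgraph} {x w : G} {W : {set G}} :
  x \notin W -> w \in W -> adj x w -> dist_set x W = 1.
Proof.
move=> xW wW xw; apply/eqP; rewrite eqn_leq.
rewrite (leq_trans (dist_set_le x wW) (dist_adj xw)) /=.
apply: dist_set_ge; first by apply/card_gt0P; exists x.
move=> v vW; rewrite lt0n dist_eq0.
by apply: contraNneq xW => ->.
Qed.

(** Either equation makes the two distances to [W] differ by the distance of [x] and [y], which is
    positive. *)
Lemma strongly_resolves_neq {G : cgraph} {W : {set G}} {x y : G} :
  strongly_resolves W x y -> dist_set x W <> dist_set y W.
Proof.
case/and4P=> xy _ _ /orP[]/eqP dE xyW.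
  by move: xy (dist_eq0 x y) => /negPf ->; lia.
by move: xy (dist_eq0 y x); rewrite eq_sym => /negPf ->; lia.
Qed.

(** * The lollipop graph and its metric *)

(** [i - m] is truncated: it vanishes exactly on the twins. *)
Definition lollipop_adj (m : nat) {n : nat} : rel 'I_n :=
  fun i j => [&& i != j, i - m <= (j - m).+1 & j - m <= (i - m).+1].

(** The sum of truncated differences is an absolute value; [maxn] corrects it from 0 to 1 for two
    distinct twins. *)
Definition lollipop_dist (m : nat) {n : nat} (i j : 'I_n) : nat :=
  maxn (i != j) (((i - m) - (j - m)) + ((j - m) - (i - m))).

Lemma lollipop_adj_sym (m n : nat) : symmetric (@lollipop_adj m n).
Proof. by move=> i j; rewrite /lollipop_adj eq_sym [X in _ && X]andbC. Qed.

Lemma lollipop_adj_irrefl (m n : nat) : irreflexive (@lollipop_adj m n).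
Proof. by move=> i; rewrite /lollipop_adj eqxx. Qed.

Lemma lollipop_dist_refl m n (i : 'I_n) : lollipop_dist m i i = 0.
Proof. by rewrite /lollipop_dist eqxx subnn. Qed.

Lemma lollipop_dist_adj m n {i j k : 'I_n} :
  lollipop_adj m i k -> lollipop_dist m i j <= (lollipop_dist m k j).+1.
Proof.
by case/and3P; rewrite /lollipop_dist -!val_eqE /=; lia.
Qed.

Lemma lollipop_dist_step m n {i j : 'I_n} : i != j ->
  exists2 k, lollipop_adj m i k
           & lollipop_dist m i j = (lollipop_dist m k j).+1.
Proof.
move=> ij; have [ltin ltjn] := (ltn_ord i, ltn_ord j).
have [ij_adj|] := boolP (lollipop_adj m i j).
  exists j => //; rewrite lollipop_dist_refl.
  by case/and3P: ij_adj; rewrite /lollipop_dist -!val_eqE /=; lia.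
rewrite /lollipop_adj ij /= => ij_far.
have [lt_ij|le_ji] := ltnP i j.
  (* A twin [i] must step to [m.+1], any other [i] to [i.+1]; this formula covers both. *)
  have lt_k : m + (i - m).+1 < n by lia.
  by exists (Ordinal lt_k); rewrite /lollipop_dist -!val_eqE /=; lia.
have lt_k : i.-1 < n by lia.
by exists (Ordinal lt_k); rewrite /lollipop_dist -!val_eqE /=; lia.
Qed.

Lemma lollipop_connected m n (i j : 'I_n) : connect (lollipop_adj m) i j.
Proof.
have [k] := ubnP (lollipop_dist m i j); elim: k i => // k IHk i.
have [-> _|/(lollipop_dist_step m n)[l il ->]] := eqVneq i j; first exact: connect0.
by rewrite ltnS => /IHk; apply/connect_trans/connect1.
Qed.

Definition lollipop (m n : nat) : cgraph :=
  CGraph (@lollipop_adj_sym m n) (@lollipop_adj_irrefl m n)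
         (@lollipop_connected m n).

Lemma lollipop_distE m n (x y : lollipop m n) :
  dist x y = lollipop_dist m x y.
Proof.
apply: (@dist_unique (lollipop m n)) => {x y}.
- exact: lollipop_dist_refl.
- by move=> x y z; apply: lollipop_dist_adj.
- exact: lollipop_dist_step.
Qed.

(** * Upper bound: a strong resolving partition into [m.+2] blocks *)

Definition lollipop_block (m n i : nat) : {set lollipop m n} :=
  [set x : 'I_n | minn x m.+1 == i].

Lemma lollipop_dist_block0 m n (x : lollipop m n) :
  m.+1 <= (x : 'I_n) -> dist_set x (lollipop_block m n 0) = (x : 'I_n) - m.
Proof.
move=> lt_mx; have lt_xn := ltn_ord x; have lt_0n : 0 < n by lia.
have x0E y : y \in lollipop_block m n 0 -> dist x y = (x : 'I_n) - m.
  by rewrite inE lollipop_distE /lollipop_dist -!val_eqE /=; lia.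
apply/eqP; rewrite eqn_leq; apply/andP; split.
  have in0 : (Ordinal lt_0n : lollipop m n) \in lollipop_block m n 0.
    by rewrite inE min0n.
  by rewrite -(x0E _ in0); apply: dist_set_le.
apply: dist_set_ge => [|y /x0E -> //].
by rewrite card_ord; lia.
Qed.

Lemma lollipop_block_partition m n : m.+2 <= n ->
  ordered_partition [seq lollipop_block m n i | i <- iota 0 m.+2].
Proof.
move=> le_mn.
have block_self i (lt_in : i < n) :
    i < m.+2 -> (Ordinal lt_in : lollipop m n) \in lollipop_block m n i.
  by rewrite inE /=; lia.
apply/andP; split.
  rewrite map_inj_in_uniq ?iota_uniq // => i j; rewrite !mem_iota /= => lt_i lt_j.
  have lt_in : i < n by lia.
  move/setP/(_ (Ordinal lt_in)); rewrite block_self // inE /=; lia.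
apply/and3P; split.
- apply/eqP/setP => x; rewrite inE; apply/bigcupP.
  exists (lollipop_block m n (minn (x : 'I_n) m.+1)); last by rewrite inE.
  by rewrite inE map_f // mem_iota; lia.
- apply/trivIsetP => A B; rewrite !in_set => /mapP[i _ ->] /mapP[j _ ->] ij.
  rewrite -setI_eq0; apply: contraR ij => /set0Pn[x].
  by rewrite !inE => /andP[/eqP <- /eqP <-].
- rewrite inE; apply/mapP => -[i]; rewrite mem_iota /= => lt_i.
  have lt_in : i < n by lia.
  by move/setP/(_ (Ordinal lt_in)); rewrite block_self // inE.
Qed.

Lemma lollipop_strong_resolving m n : m.+2 <= n ->
  has_strong_resolving_partition (lollipop m n) m.+2.
Proof.
move=> le_mn; pose s := [seq lollipop_block m n i | i <- iota 0 m.+2].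
have sz_s : size s == m.+2 by rewrite size_map size_iota.
apply/existsP; exists (Tuple sz_s).
rewrite /strong_resolving_partition lollipop_block_partition // andTb.
apply/allP => A /mapP[i _ ->].
apply/forall_inP => x; rewrite inE => /eqP xi.
apply/forall_inP => y; rewrite inE => /eqP yi.
apply/implyP => xy; apply/hasP; exists (lollipop_block m n 0).
  by rewrite map_f // mem_iota.
have vxy : (x : 'I_n) <> y :> nat by move/val_inj/eqP; apply/negP.
(* Blocks with index at most [m] are singletons, so distinct [x] and [y] lie in the last one. There
   the distances to vertex 0 are [x - m] and [y - m], and they differ by the distance of [x] and [y]
   along the path. *)
have [lt_mx lt_my] : m.+1 <= (x : 'I_n) /\ m.+1 <= (y : 'I_n) by lia.
apply/and4P; split=> //; rewrite ?inE; try lia.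
rewrite !lollipop_dist_block0 // !lollipop_distE /lollipop_dist -!val_eqE /=.
by lia.
Qed.

(** * Lower bound: fewer than [m.+2] blocks do not suffice *)

Lemma lollipop_twins m n (x y : lollipop m n) (W : {set lollipop m n}) :
  (x : 'I_n) <= m -> (y : 'I_n) <= m -> ~~ strongly_resolves W x y.
Proof.
move=> le_xm le_ym; apply/negP => xyW; have /and4P[_ xW yW _] := xyW.
apply: (strongly_resolves_neq xyW); apply: eq_bigr => w wW.
have [xw yw] : x != w /\ y != w.
  by split; [apply: contraNneq xW | apply: contraNneq yW] => ->.
move: xw yw; rewrite !lollipop_distE /lollipop_dist => /negPf -> /negPf ->.
by lia.
Qed.

Lemma lollipop_lower m n k : m.+2 <= n ->
  has_strong_resolving_partition (lollipop m n) k -> m.+2 <= k.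
Proof.
move=> le_mn /existsP[Pi /andP[/andP[uPi partPi] /allP resPi]].
have cardPi : #|[set:: Pi]| = k by rewrite cardsE (card_uniqP uPi) size_tuple.
have /and3P[/eqP covPi tiPi _] := partPi.
have blockPi x : pblock [set:: Pi] x \in Pi.
  by have := @pblock_mem _ [set:: Pi] x; rewrite inE covPi inE; apply.
have in_block (x : lollipop m n) : x \in pblock [set:: Pi] x.
  by rewrite mem_pblock covPi.
have resolved (x y : lollipop m n) : x != y ->
    pblock [set:: Pi] x = pblock [set:: Pi] y ->
    exists2 W, W \in Pi & strongly_resolves W x y.
  move=> xy xyP; have /forall_inP/(_ x (in_block x)) := resPi _ (blockPi x).
  rewrite xyP => /forall_inP/(_ y (in_block y)).
  by rewrite xy => /hasP.
rewrite leqNgt; apply/negP => lt_k.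
(* Here [f] lists the [m.+1] twins and [g] the [m.+2] vertices of the clique. *)
pose f (i : 'I_m.+1) : lollipop m n := widen_ord (ltnW le_mn) i.
pose g (i : 'I_m.+2) : lollipop m n := widen_ord le_mn i.
have f_inj : injective (fun i => pblock [set:: Pi] (f i)).
  move=> i j ijP; apply/eqP; apply: contraT => ij.
  have fij : f i != f j by rewrite -val_eqE.
  have [W _] := resolved _ _ fij ijP.
  by rewrite (negPf (lollipop_twins _ _ _ _ _ _ _)) //= -ltnS.
have twin_block W : W \in Pi -> exists i, f i \in W.
  move=> WPi; pose B := [set pblock [set:: Pi] (f i) | i : 'I_m.+1].
  have BPi : B = [set:: Pi].
    (* The twins occupy [m.+1] distinct blocks, and there are at most [m.+1] blocks in all. *)
    apply/eqP; rewrite eqEcard card_imset // card_ord cardPi andbC.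
    rewrite -ltnS lt_k; apply/subsetP => A /imsetP[i _ ->].
    by rewrite inE.
  have : W \in B by rewrite BPi inE.
  by case/imsetP=> i _ ->; exists i.
have /injectivePn[i [j ij ijP]] :
    ~~ injectiveb (fun i => pblock [set:: Pi] (g i)).
  apply/injectiveP => g_inj; move: lt_k; rewrite ltnNge => /negP; apply.
  rewrite -cardPi -[m.+2]card_ord -(card_imset _ g_inj).
  by apply/subset_leq_card/subsetP => A /imsetP[l _ ->]; rewrite inE.
have gij : g i != g j by rewrite -val_eqE.
have [W WPi ijW] := resolved _ _ gij ijP.
have [t tW] := twin_block W WPi.
(* The twin [f t] in [W] is adjacent to every other clique vertex. *)
have dist1 l : g l \notin W -> dist_set (g l) W = 1.
  move=> lW; apply: (dist_set_adj lW tW); apply/and3P; split.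
  - by apply: contraNneq lW => ->.
  - by have := ltn_ord l; rewrite /=; lia.
  - by have := ltn_ord t; rewrite /=; lia.
have /and4P[_ iW jW _] := ijW.
by apply: (strongly_resolves_neq ijW); rewrite !dist1.
Qed.

Theorem theorem8 (r n : nat) (hr : 2 <= r) (hrn : r <= n) :
  exists G : cgraph, #|G| = n /\ pd_s G = r.
Proof.
case: r hr hrn => [|[|m]] // _ le_mn.
exists (lollipop m n); split; first by rewrite card_ord.
rewrite /pd_s; case: ex_minnP => k k_res kmin; apply/eqP; rewrite eqn_leq.
by rewrite kmin ?lollipop_strong_resolving //= (lollipop_lower m n).
Qed.
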